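(* For every positive integer $n$, $g(n)\le h_2(n,\{rrr,rrb,yyr\})\le 2g(n)$.
   Context: Edge-colorings of the complete graph $K_n$ use colors from $\{r,b,y\}$ (red, blue, yellow); they need not be proper, and not all colors need be used. A pattern is an edge-colored triangle, denoted by the multiset of the colors of its three edges; e.g. $rrr$ is the all-red triangle, $rrb$ is the triangle with two red edges and one blue edge, and $yyr$ has two yellow edges and one red edge. For a family $\mathcal{H}$ of patterns, $\operatorname{Forb}(n,\mathcal{H})$ is the set of all edge-colorings of $K_n$ with colors from $\{r,b,y\}$ in which no triangle has a coloring belonging to $\mathcal{H}$. For an edge-coloring $c$ of $K_n$, $h_2(c)$ is the maximum $k$ such that there is a set of $k$ vertices whose induced edges use at most two of the three colors. Finally, $h_2(n,\mathcal{H})=\min\{h_2(c): c\in\operatorname{Forb}(n,\mathcal{H})\}$. The odd girth $g_{\rm odd}(G)$ of a graph $G$ is the length of a shortest odd cycle in $G$ (taken to be $\infty$ if $G$ has no odd cycle), and $\alpha(G)$ is the independence number. Define $g(n)=\min\{\alpha(G): |V(G)|=n,\ g_{\rm odd}(G)\ge 7\}$; equivalently, the minimum of $\alpha(G)$ over $n$-vertex graphs $G$ with no cycle of length $3$ and no cycle of length $5$. *)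

(* Defs.v *)
From HB Require Import structures.
From mathcomp Require Import all_boot.
Set Implicit Arguments.
Unset Strict Implicit.
Unset Printing Implicit Defensive.

Inductive color := Red | Blue | Yellow.

Definition color_to_ord (a : color) : 'I_3 :=
  match a with
  | Red => @Ordinal 3 0 isT
  | Blue => @Ordinal 3 1 isT
  | Yellow => @Ordinal 3 2 isT
  end.
Definition ord_to_color (i : 'I_3) : color :=
  match val i with 0 => Red | 1 => Blue | _ => Yellow end.
Lemma color_to_ordK : cancel color_to_ord ord_to_color.
Proof. by case. Qed.
HB.instance Definition _ := Finite.copy color (can_type color_to_ordK).

(* The edges of K_n on the vertex set {0, ..., n-1}. *)
Notation edge n := {e : {set 'I_n} | #|e| == 2}.
Notation coloring n := {ffun edge n -> color}.
(* A simple graph on {0, ..., n-1} is identified with its edge set. *)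
Notation graph n := {set edge n}.

(* The minimum of f over A; the value 0 for empty A is junk, never reached in
   h2_min at the family studied (all_blue_Forb) nor in g
   (empty_graph_odd_girth). *)
Definition min_over (T : finType) (A : {set T}) (f : T -> nat) : nat :=
  if [pick x in A] is Some x0 then f [arg min_(x < x0 in A) f x] else 0.

Lemma min_overP (T : finType) (A : {set T}) (f : T -> nat) : A != set0 ->
  (exists2 x, x \in A & f x = min_over A f) /\
  (forall x, x \in A -> min_over A f <= f x).
Proof.
case/set0Pn=> x Ax; rewrite /min_over; case: pickP => [x0 Ax0|/(_ x)]; last first.
  by rewrite Ax.
by case: arg_minnP => // i Ai mi; split=> //; exists i.
Qed.

(* Patterns are multisets of colors, i.e. sequences taken up to perm_eq. *)
Definition triangle_colors n (c : coloring n) (T : {set 'I_n}) : seq color :=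
  [seq c e | e : edge n in [pred e : edge n | val e \subset T]].

Definition Forb n (H : seq (seq color)) : {set coloring n} :=
  [set c | [forall T : {set 'I_n}, (#|T| == 3) ==>
              ~~ has (perm_eq (triangle_colors c T)) H]].

Definition colors_in n (c : coloring n) (S : {set 'I_n}) : {set color} :=
  [set c e | e : edge n & val e \subset S].

Definition h2 n (c : coloring n) : nat :=
  \max_(S : {set 'I_n} | #|colors_in c S| <= 2) #|S|.

Definition h2_min n (H : seq (seq color)) : nat := min_over (Forb n H) (@h2 n).

Definition adj n (G : graph n) : rel 'I_n :=
  fun x y => [exists e in G, val e == [set x; y]].

Definition has_cycle n (G : graph n) (k : nat) : bool :=
  (2 < k) && [exists t : k.-tuple 'I_n, ucycleb (adj G) t].

(* None stands for infinity; a cycle in G has length at most n. *)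
Definition odd_girth n (G : graph n) : option nat :=
  ohead [seq k <- iota 0 n.+1 | odd k && has_cycle G k].

Definition odd_girth_ge n (m : nat) (G : graph n) : bool :=
  if odd_girth G is Some k then m <= k else true.

Definition independent n (G : graph n) (S : {set 'I_n}) : bool :=
  [forall x in S, forall y in S, ~~ adj G x y].

Definition alpha n (G : graph n) : nat :=
  \max_(S : {set 'I_n} | independent G S) #|S|.

Definition g (n : nat) : nat :=
  min_over [set G : graph n | odd_girth_ge 7 G] (@alpha n).

Definition rrr_rrb_yyr : seq (seq color) :=
  [:: [:: Red; Red; Red]; [:: Red; Red; Blue]; [:: Yellow; Yellow; Red]].

Lemma all_blue_Forb n : [ffun=> Blue] \in Forb n rrr_rrb_yyr.
Proof.
rewrite inE; apply/forallP=> T; apply/implyP=> _; apply/hasPn=> p pH.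
apply/negP=> /perm_mem/(_ Red).
have -> : Red \in p by move: pH; rewrite /rrr_rrb_yyr !inE => /or3P[] /eqP->.
by case/imageP=> e _; rewrite ffunE.
Qed.

Lemma empty_graph_odd_girth n : odd_girth_ge 7 (set0 : graph n).
Proof.
rewrite /odd_girth_ge /odd_girth (eq_filter (a2 := pred0)) ?filter_pred0 // => k.
apply/negP=> /and3P[_ k2 /existsP[[s /= /eqP sk] /andP[cs _]]].
case: s sk cs => [|x [|y s]] /= sk cs; [by rewrite -sk in k2 | by rewrite -sk in k2 |].
by case/andP: cs => /existsP[e]; rewrite inE.
Qed.

(* Main.v *)
(** Lower bound: in a coloring avoiding rrr, rrb and yyr, two red edges at a
    vertex are closed by a yellow one, so a red 5-cycle would contain a yyr
    triangle; hence the red graph has odd girth at least 7, and its independent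
    sets miss the color red.
    Upper bound: given G of odd girth at least 7, color the edges of G red, the
    pairs at distance two yellow and the rest blue.  A yyr triangle would give a
    closed walk of length 5 in G.  A vertex set missing a color is covered by two
    independent sets of G: without yellow, G induces a matching on it; without
    blue, the non-neighbors of a vertex are pairwise yellow and its neighbors
    are independent. *)
Require Import Defs.
From mathcomp Require Import all_boot.
Set Implicit Arguments.
Unset Strict Implicit.
Unset Printing Implicit Defensive.

(** * Graphs: short odd cycles and independent sets *)

Section Edges.
Variable n : nat.
Implicit Types (G : graph n) (x y z : 'I_n).

Definition mk_edge x y (xy : x != y) : edge n :=
  exist _ [set x; y] (introT eqP (etrans (cards2 x y) (congr1 S (congr1 nat_of_bool xy)))).

Lemma adj_neq G x y : adj G x y -> x != y.
Proof.
case/existsP=> -[e e2] /andP[_ /eqP /= ee].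
by move: e2; rewrite ee cards2; case: (x != y).
Qed.

Lemma adj_sym G : symmetric (adj G).
Proof. by move=> x y; rewrite /adj setUC. Qed.

Lemma adj_mk_edge G x y (xy : x != y) : adj G x y = (mk_edge xy \in G).
Proof.
apply/existsP/idP => [[e /andP[eG /eqP ee]]|eG].
  by rewrite (_ : mk_edge _ = e) //; apply: val_inj.
by exists (mk_edge xy); rewrite eG /=.
Qed.

Lemma mk_edge_eq x y u v (xy : x != y) (uv : u != v) :
  (mk_edge xy == mk_edge uv) = (x == u) && (y == v) || (x == v) && (y == u).
Proof.
rewrite -val_eqE /= eqEsubset !subUset !sub1set !inE !(eq_sym u) !(eq_sym v).
have [xu|_] := eqVneq x u; have [yv|_] := eqVneq y v;
  have [xv|_] := eqVneq x v; have [yu|_] := eqVneq y u => //=;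
  subst; by rewrite ?eqxx in xy uv.
Qed.

Lemma mk_edgeP (e : edge n) : exists x y (xy : x != y), e = mk_edge xy.
Proof.
case: e => A A2; have /cards2P[x [y [xy eA]]] := A2.
by exists x, y, xy; apply: val_inj.
Qed.

(** A cycle has distinct vertices, so its length is at most [n] and the search range of [odd_girth]
    loses nothing; the filtered list is sorted, so its head is the least odd cycle length. *)
Lemma odd_girth_geP m G :
  reflect (forall k, k < m -> odd k -> ~~ has_cycle G k) (odd_girth_ge m G).
Proof.
have cyc_le k : has_cycle G k -> k < n.+1.
  case/andP=> _ /existsP[t /andP[_ ut]].
  by rewrite ltnS -(size_tuple t) -(card_uniqP ut) -[leqRHS]card_ord max_card.
rewrite /odd_girth_ge /odd_girth; set s := filter _ _.
have sE k : (k \in s) = odd k && has_cycle G k.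
  rewrite mem_filter mem_iota leq0n add0n andbC.
  by case E: (has_cycle G k); rewrite ?andbF // (cyc_le _ E).
have: sorted leq s by apply: sorted_filter (iota_sorted _ _); apply: leq_trans.
case: s sE => [|k s] sE /= ss.
  apply: (iffP idP) => // _ k _ ok; apply/negP=> ck.
  by have:= sE k; rewrite in_nil ok ck.
apply: (iffP idP) => [mk j jm oj|H].
  apply/negP=> cj; have:= sE j; rewrite oj cj inE => /orP[/eqP jk|js].
    by rewrite jk ltnNge mk in jm.
  have /allP/(_ _ js) kj := order_path_min leq_trans ss.
  by rewrite ltnNge (leq_trans mk kj) in jm.
rewrite leqNgt; apply/negP=> km.
have:= sE k; rewrite mem_head => /esym/andP[ok ck].
by have:= H _ km ok; rewrite ck.
Qed.

Lemma has_cycle_uniq G (s : seq 'I_n) :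
  2 < size s -> cycle (adj G) s -> uniq s -> has_cycle G (size s).
Proof.
move=> s2 cs us; rewrite /has_cycle s2; apply/existsP; exists (in_tuple s).
by rewrite /ucycleb cs.
Qed.

Lemma no_triangle G x y z :
  odd_girth_ge 7 G -> adj G x y -> adj G y z -> ~~ adj G x z.
Proof.
move=> /odd_girth_geP/(_ 3 isT isT) no3 xy yz; apply: contra no3 => xz.
apply: (@has_cycle_uniq _ [:: x; y; z]) => //=.
  by rewrite xy yz adj_sym xz.
by rewrite !inE negb_or (adj_neq xy) (adj_neq yz) (adj_neq xz).
Qed.

(** If two non-consecutive vertices of the closed walk coincided, a triangle would remain, so the
    five vertices are distinct and form a 5-cycle. *)
Lemma no_closed_walk5 G x a z b y : odd_girth_ge 7 G ->
  adj G x a -> adj G a z -> adj G z b -> adj G b y -> ~~ adj G x y.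
Proof.
move=> G7 xa az zb yb; apply/negP=> xy.
have tri := fun u v w => @no_triangle G u v w G7.
have xz : x != z.
  by apply: contraTneq xy => ->; apply: tri zb yb.
have yz : z != y.
  by apply: contraTneq xy => <-; apply: tri xa az.
have ab : a != b.
  by apply: contraTneq xy => eab; apply: tri xa _; rewrite eab.
have ay : a != y.
  apply: contraTneq az => ->; rewrite adj_sym; exact: tri zb yb.
have bx : x != b.
  by apply: contraTneq zb => <-; rewrite adj_sym; exact: tri xa az.
have /odd_girth_geP/(_ 5 isT isT)/negP[] := G7.
apply: (@has_cycle_uniq _ [:: x; a; z; b; y]) => //=.
  by rewrite xa az zb yb adj_sym xy.
by rewrite !inE !negb_or xz yz ab ay bx !(@adj_neq G).
Qed.

Lemma independent_le_alpha G S : independent G S -> #|S| <= alpha G.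
Proof. exact: leq_bigmax_cond. Qed.

Lemma two_independent_le_alpha G (S A B : {set 'I_n}) :
  S \subset A :|: B -> independent G A -> independent G B -> #|S| <= 2 * alpha G.
Proof.
move=> /subset_leq_card/leq_trans SAB iA iB; apply: SAB.
by rewrite (leq_trans (leq_card_setU _ _)) // mul2n -addnn leq_add //
   independent_le_alpha.
Qed.

Lemma independentP G (S : {set 'I_n}) :
  reflect {in S &, forall x y, ~~ adj G x y} (independent G S).
Proof.
apply: (iffP forall_inP) => H x; first by move=> y /H/forall_inP; apply.
by move=> xS; apply/forall_inP => y; apply: H.
Qed.

Lemma max_degree1_le_alpha G (S : {set 'I_n}) :
  {in S & &, forall x y z, adj G x y -> adj G x z -> y = z} ->
  #|S| <= 2 * alpha G.
Proof.
(* The set A takes the lower endpoint of each edge, and the isolated vertices. *)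
move=> deg1; pose A := [set x in S | [forall y in S, adj G x y ==> (x < y)]].
apply: (@two_independent_le_alpha _ _ A (S :\: A)).
- by apply/subsetP => x xS; rewrite !in_setU in_setD xS andbT orbN.
- apply/independentP => x y; rewrite !inE => /andP[xS /forall_inP xP].
  case/andP=> yS /forall_inP yP; apply/negP=> xy.
  have:= xP _ yS; have:= yP _ xS; rewrite adj_sym xy /= => yx.
  by rewrite ltnNge ltnW.
have BP u : u \in S :\: A -> u \in S /\ exists2 v, v \in S & adj G u v && (v <= u).
  rewrite !inE andbC; case uS: (u \in S) => //= /forall_inPn[v vS].
  by rewrite negb_imply -leqNgt; split=> //; exists v.
(* Adjacent [x] and [y] are each other's only neighbor in [S], so each would be at most the other,
   which forces [x = y]. *)
apply/independentP => x y /BP[xS [x' x'S /andP[xx' lx]]] /BP[yS [y' y'S /andP[yy' ly]]].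
apply/negP=> xy; have:= adj_neq xy; rewrite -val_eqE eqn_leq.
have <- : x' = y by apply: (deg1 x).
have -> : val x' <= x by [].
by rewrite -(deg1 y y' x) // 1?adj_sym // (deg1 x x' y) // ly.
Qed.

End Edges.

(** * Color classes, forbidden patterns and the lower bound *)

Section Colorings.
Variable n : nat.
Implicit Types (c : coloring n) (x y z : 'I_n).

Definition color_class c (a : color) : graph n := [set e | c e == a].

Lemma color_class_mk_edge c a x y (xy : x != y) :
  adj (color_class c a) x y = (c (mk_edge xy) == a).
Proof. by rewrite adj_mk_edge inE. Qed.

Lemma color_class_inj c a b x y :
  adj (color_class c a) x y -> adj (color_class c b) x y -> a = b.
Proof.
move=> xya; have xy := adj_neq xya.
by move: xya; rewrite !(color_class_mk_edge _ _ xy) => /eqP-> /eqP.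
Qed.

Lemma color_class_total c x y : x != y -> exists a, adj (color_class c a) x y.
Proof. by move=> xy; exists (c (mk_edge xy)); rewrite color_class_mk_edge. Qed.

(** The edges inside the triple are exactly these three, listed in an arbitrary enumeration order;
    hence [perm_eq]. *)
Lemma triangle_colorsE c x y z (xy : x != y) (yz : y != z) (xz : x != z) :
  perm_eq (triangle_colors c [set x; y; z])
    [:: c (mk_edge xy); c (mk_edge yz); c (mk_edge xz)].
Proof.
rewrite -[X in perm_eq _ X]/(map c [:: mk_edge xy; mk_edge yz; mk_edge xz]).
apply/perm_map/uniq_perm; first exact: enum_uniq.
  rewrite /= !inE !mk_edge_eq (eq_sym y x) (eq_sym z x).
  by rewrite (negPf xy) (negPf yz) (negPf xz) !andbF.
move=> e; rewrite mem_enum !inE.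
have [u [v [uv ->]]] := mk_edgeP e.
rewrite !mk_edge_eq /= subUset !sub1set !inE.
have [Ex|_] := eqVneq u x; have [Ey|_] := eqVneq u y; have [Ez|_] := eqVneq u z;
have [Fx|_] := eqVneq v x; have [Fy|_] := eqVneq v y; have [Fz|_] := eqVneq v z => //;
subst; by rewrite ?eqxx in xy yz xz uv.
Qed.

Lemma card_set3 (T : finType) (x y z : T) :
  x != y -> y != z -> x != z -> #|[set x; y; z]| = 3.
Proof.
move=> xy yz xz.
by rewrite setUC cardsU1 !inE cards2 xy ![z == _]eq_sym negb_or xz yz.
Qed.

Lemma cards3P (T : finType) (A : {set T}) : #|A| = 3 ->
  exists x y z : T, [/\ x != y, y != z, x != z & A = [set x; y; z]].
Proof.
move=> A3; have: 2 < #|A| by rewrite A3.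
case/card_gt2P=> x [y [z [[xA yA zA] [xy yz]]]]; rewrite eq_sym => xz.
exists x, y, z; split=> //; apply/esym/eqP; rewrite eqEcard A3 card_set3 // andbT.
by rewrite !subUset !sub1set xA yA.
Qed.

(** Stating colors as adjacency in color classes spares later arguments the distinctness proofs that
    [mk_edge] carries. *)
Lemma ForbP H c :
  reflect (forall x y z a b d, adj (color_class c a) x y ->
             adj (color_class c b) y z -> adj (color_class c d) x z ->
             ~~ has (perm_eq [:: a; b; d]) H)
          (c \in Forb n H).
Proof.
rewrite inE; apply: (iffP forall_inP) => [F x y z a b d xya yzb xzd|F T].
  have xy := adj_neq xya; have yz := adj_neq yzb.
  have xz := adj_neq xzd.
  move: xya yzb xzd (F _ (introT eqP (card_set3 xy yz xz))).
  rewrite (color_class_mk_edge _ _ xy) (color_class_mk_edge _ _ yz).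
  rewrite (color_class_mk_edge _ _ xz) => /eqP<- /eqP<- /eqP<-.
  by rewrite (eq_has (permPl (triangle_colorsE c xy yz xz))).
case/eqP/cards3P=> x [y [z [xy yz xz ->]]].
rewrite (eq_has (permPl (triangle_colorsE c xy yz xz))).
by apply: (F x y z); rewrite color_class_mk_edge.
Qed.

Lemma colors_inP c (S : {set 'I_n}) a :
  reflect (exists x y, [/\ x \in S, y \in S & adj (color_class c a) x y])
          (a \in colors_in c S).
Proof.
apply: (iffP imsetP) => [[e]|[x [y [xS yS xya]]]].
  rewrite inE; have [x [y [xy ->]]] := mk_edgeP e => /=.
  rewrite subUset !sub1set => /andP[xS yS] ->; exists x, y; split=> //.
  by rewrite color_class_mk_edge.
have xy := adj_neq xya; exists (mk_edge xy).
  by rewrite inE subUset !sub1set xS.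
by move: xya; rewrite color_class_mk_edge => /eqP.
Qed.

Lemma card_color : #|{: color}| = 3.
Proof.
by rewrite -(card_ord 3); apply: (bij_eq_card (f := color_to_ord));
  exists ord_to_color; [apply: color_to_ordK | move=> [[|[|[|]]] i] //; apply: val_inj].
Qed.

(** There are exactly three colors, so using at most two means missing one. *)
Lemma colors_in_le2 c (S : {set 'I_n}) :
  reflect (exists a, {in S &, forall x y, ~~ adj (color_class c a) x y})
          (#|colors_in c S| <= 2).
Proof.
have -> : (#|colors_in c S| <= 2) = (~: colors_in c S != set0).
  by rewrite -card_gt0 [#|~: _|]cardsCs setCK card_color subn_gt0.
apply: (iffP (set0Pn _)) => -[a Ha]; exists a.
  move=> x y xS yS; move: Ha; rewrite inE; apply: contra => xy.
  by apply/colors_inP; exists x, y.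
by rewrite inE; apply/colors_inP => -[x [y [xS yS]]]; apply/negP/Ha.
Qed.

Lemma h2_ge_alpha_red c : alpha (color_class c Red) <= h2 c.
Proof.
apply/bigmax_leqP => S /independentP iS; apply: leq_bigmax_cond.
by apply/colors_in_le2; exists Red.
Qed.

Lemma odd_girth_red c : c \in Forb n rrr_rrb_yyr -> odd_girth_ge 7 (color_class c Red).
Proof.
move=> /ForbP F.
(* The pattern [rrr] rules out a red closing edge, and [rrb] a blue one. *)
have red2 x y z : adj (color_class c Red) x y -> adj (color_class c Red) y z ->
    x != z -> adj (color_class c Yellow) x z.
  move=> xy yz xz; have [a xza] := color_class_total c xz.
  by have:= F _ _ _ _ _ _ xy yz xza; case: a xza.
apply/odd_girth_geP => k k7 ok; apply/negP => /andP[k2 /existsP[[s /= sk]]].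
have: (size s == 3) || (size s == 5).
  by rewrite (eqP sk); case: k k7 ok k2 sk => [|[|[|[|[|[|[|[]]]]]]]].
rewrite /ucycleb.
case/orP; case: s {sk} => [|x [|y [|z []]]] //=.
  move=> _ /andP[/and4P[xy yz zx _]]; have:= F _ _ _ _ _ _ xy yz.
  by move/(_ Red); rewrite adj_sym => /(_ zx).
move=> v [|w []] //= _ /andP[/and5P[xy yz zv vw /andP[wx _]]].
rewrite !inE !negb_or => /and3P[/and4P[_ xz xv _] _ _].
(* In the red 5-cycle [x y z v w] the chords [xz] and [vx] are yellow; with the red edge [zv] they
   form [yyr]. *)
have xzY := red2 _ _ _ xy yz xz.
have := red2 _ _ _ vw wx; rewrite eq_sym => /(_ xv) vxY.
by have:= F _ _ _ _ _ _ vxY xzY; move/(_ Red); rewrite adj_sym => /(_ zv).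
Qed.

End Colorings.

(** * The distance-two coloring and the upper bound *)

Section Distance2.
Variables (n : nat) (G : graph n).
Hypothesis G7 : odd_girth_ge 7 G.

Definition distance2_coloring : coloring n :=
  [ffun e => if e \in G then Red
    else if [exists x, exists y, exists z,
          [&& val e == [set x; z], adj G x y & adj G y z]] then Yellow
    else Blue].

Let c := distance2_coloring.

Lemma distance2_red x y : adj (color_class c Red) x y = adj G x y.
Proof.
have [->|xy] := eqVneq x y.
  by apply/idP/idP => /adj_neq; rewrite eqxx.
rewrite color_class_mk_edge adj_mk_edge ffunE.
by case: ifP => // _; case: ifP.
Qed.

(** Since [G] has no triangle, vertices with a common neighbor are not adjacent, so the red test,
    made first, never hides a yellow pair. *)
Lemma distance2_yellow x y : reflect (x != y /\ exists2 z, adj G x z & adj G z y)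
  (adj (color_class c Yellow) x y).
Proof.
apply: (iffP idP) => [xyY|[xy [z xz zy]]].
  have xy := adj_neq xyY; split=> //; move: xyY.
  rewrite color_class_mk_edge ffunE; case: ifP => // _; case: ifP => // /existsP[u].
  case/existsP=> z /existsP[v] /and3P[/eqP /= E uz zv] _.
  have /setP/(_ x) := E; have /setP/(_ y) := E; rewrite !inE !eqxx /= orbT.
  move=> /esym/orP[]/eqP ? /esym/orP[]/eqP ?; subst; first by rewrite eqxx in xy.
  - by exists z; rewrite adj_sym.
  - by exists z.
  - by rewrite eqxx in xy.
rewrite color_class_mk_edge ffunE -adj_mk_edge (negPf (no_triangle G7 xz zy)) /=.
case: ifP => // /negbT/negP[]; apply/existsP; exists x; apply/existsP; exists z.
by apply/existsP; exists y; rewrite eqxx xz.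
Qed.

(** The two common neighbors give a walk of length 4 from [x] to [z], which an edge [xz] would close
    to length 5. *)
Lemma distance2_yyr x y z : adj (color_class c Yellow) x y ->
  adj (color_class c Yellow) y z -> ~~ adj G x z.
Proof.
move=> /distance2_yellow[_ [u xu uy]] /distance2_yellow[_ [v yv vz]].
exact: no_closed_walk5 G7 xu uy yv vz.
Qed.

Lemma distance2_coloring_Forb : c \in Forb n rrr_rrb_yyr.
Proof.
have rr x y z a : adj (color_class c Red) x y -> adj (color_class c Red) y z ->
    adj (color_class c a) x z -> a = Yellow.
  rewrite !distance2_red => xy yz xza; apply: (color_class_inj xza).
  by apply/distance2_yellow; split; [apply: adj_neq xza | exists y].
have yy x y z : adj (color_class c Yellow) x y ->
    adj (color_class c Yellow) y z -> ~~ adj (color_class c Red) x z.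
  by rewrite distance2_red; apply: distance2_yyr.
apply/ForbP => x y z a b d xy yz xz.
(* Patterns are unordered: the vertex shared by two edges of the same color can be any of the three,
   so reversed copies of the edges are kept. *)
have yx := xy; have zy := yz; have zx := xz.
rewrite adj_sym in yx; rewrite adj_sym in zy; rewrite adj_sym in zx.
case: a xy yx => xy yx; case: b yz zy => yz zy; case: d xz zx => xz zx //.
all: try by have:= rr _ _ _ _ xy yz xz.
all: try by have:= rr _ _ _ _ yx xz yz.
all: try by have:= rr _ _ _ _ xz zy xy.
all: try by have:= yy _ _ _ xy yz; rewrite xz.
all: try by have:= yy _ _ _ yx xz; rewrite yz.
all: try by have:= yy _ _ _ xz zy; rewrite xy.
Qed.

Lemma h2_distance2_coloring : h2 c <= 2 * alpha G.
Proof.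
apply/bigmax_leqP => S /colors_in_le2[[] HS].
(* Red is missing: [S] itself is independent in [G]. *)
- rewrite mul2n -addnn; apply/(leq_trans _ (leq_addr _ _))/independent_le_alpha.
  by apply/independentP => x y xS yS; rewrite -distance2_red HS.
(* Blue is missing: [S] is split by adjacency to any vertex [v] of [S], with [v] among its own
   non-neighbors. *)
- have [->|/set0Pn[v vS]] := eqVneq S set0; first by rewrite cards0.
  apply: (@two_independent_le_alpha _ _ _ [set x | adj G v x]
            [set x in S | ~~ adj G v x]).
  + by apply/subsetP => x xS; rewrite !inE xS orbN.
  + apply/independentP => x y; rewrite !inE adj_sym; exact: no_triangle.
  have Y u : u \in S -> ~~ adj G v u -> u != v -> adj (color_class c Yellow) u v.
    move=> uS vu uv; have [a uva] := color_class_total c uv.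
    case: a uva => //; first by rewrite distance2_red adj_sym (negPf vu).
    by rewrite (negPf (HS _ _ uS vS)).
  apply/independentP => x y; rewrite !inE => /andP[xS vx] /andP[yS vy].
  have [->//|xv] := eqVneq x v.
  have [->//|yv] := eqVneq y v; first by rewrite adj_sym.
  by apply: distance2_yyr (Y _ xS vx xv) _; rewrite adj_sym Y.
(* Yellow is missing: two distinct neighbors of [x] in [S] would be joined by a yellow edge. *)
apply: max_degree1_le_alpha => x y z xS yS zS xy xz; apply/eqP.
apply: contraNT (HS _ _ yS zS) => yz; apply/distance2_yellow; split=> //.
by exists x; rewrite // adj_sym.
Qed.

End Distance2.

(** * Combining the two bounds *)

Unset Implicit Arguments.

Theorem lemma3p17 (n : nat) (hn : 0 < n) :
  g n <= h2_min n rrr_rrb_yyr <= 2 * g n.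
Proof.
(* Both families are nonempty, so each [min_over] is attained and is not the default 0. *)
have Forb0 : Forb n rrr_rrb_yyr != set0.
  by apply/set0Pn; exists [ffun=> Blue]; apply: all_blue_Forb.
have G0 : [set G : graph n | odd_girth_ge 7 G] != set0.
  by apply/set0Pn; exists set0; rewrite inE empty_graph_odd_girth.
have [[c cF hc] hmin] := min_overP (@h2 n) Forb0.
have [[G G7 aG] gmin] := min_overP (@alpha n) G0.
rewrite /g /h2_min; apply/andP; split.
  (* The red graph of an optimal coloring [c] is a candidate for [g n]. *)
  rewrite -hc; apply: leq_trans (h2_ge_alpha_red c).
  by apply: gmin; rewrite inE odd_girth_red.
(* The coloring built from an optimal graph [G] is a candidate for [h2_min]. *)
rewrite -aG; rewrite inE in G7; apply: leq_trans (h2_distance2_coloring G7).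
exact/hmin/distance2_coloring_Forb.
Qed.
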